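(* Let $\|\cdot\|:\mathbb{R}^m\to\mathbb{R}$ be a convex functional, let $\Delta t_{FE}>0$ and $K>0$, and let $F,\tilde F:\mathbb{R}^m\to\mathbb{R}^m$ satisfy the forward Euler condition $$\|u+\Delta t\,F(u)\|\le\|u\|\quad\text{for all } u\in\mathbb{R}^m \text{ and all } 0\le\Delta t\le\Delta t_{FE},$$ and the Taylor series condition $$\left\|u+\Delta t\,F(u)+\tfrac12\Delta t^2\tilde F(u)\right\|\le\|u\|\quad\text{for all } u\in\mathbb{R}^m\text{ and all } 0\le\Delta t\le K\Delta t_{FE}.$$ Consider an explicit two-derivative multistage method $$\mathbf{y}=\mathbf{e}\,u^n+\Delta t\,S\,F(\mathbf{y})+\Delta t^2\,\hat S\,\tilde F(\mathbf{y}),\qquad \mathbf{y}=(y^{(1)},\dots,y^{(s)},u^{n+1})^T .$$ If, for some $r>0$, the following inequalities hold component-wise: $$\left(I+rS+\tfrac{2r^2}{K^2}(1-K)\hat S\right)^{-1}\mathbf{e}\ge 0,$$ $$r\left(I+rS+\tfrac{2r^2}{K^2}(1-K)\hat S\right)^{-1}\left(S-\tfrac{2r}{K}\hat S\right)\ge 0,$$ $$\tfrac{2r^2}{K^2}\left(I+rS+\tfrac{2r^2}{K^2}(1-K)\hat S\right)^{-1}\hat S\ge 0,$$ then the method preserves the strong stability property: $\|u^{n+1}\|\le\|u^n\|$ for every $u^n$ under the time-step restriction $0\le\Delta t\le r\,\Delta t_{FE}$.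
   Context: An explicit $s$-stage two-derivative multistage method has coefficients given by strictly lower triangular real $s\times s$ matrices $A=(a_{ij})$, $\hat A=(\hat a_{ij})$ and vectors $b,\hat b\in\mathbb{R}^s$, and reads $y^{(1)}=u^n$, $$y^{(i)}=u^n+\Delta t\sum_{j=1}^{i-1}a_{ij}F(y^{(j)})+\Delta t^2\sum_{j=1}^{i-1}\hat a_{ij}\tilde F(y^{(j)}),\quad i=2,\dots,s,$$ $$u^{n+1}=u^n+\Delta t\sum_{j=1}^{s}b_jF(y^{(j)})+\Delta t^2\sum_{j=1}^{s}\hat b_j\tilde F(y^{(j)}).$$ The $(s+1)\times(s+1)$ matrices are $$S=\begin{bmatrix}A&\mathbf 0\\ b^T&0\end{bmatrix},\qquad \hat S=\begin{bmatrix}\hat A&\mathbf 0\\ \hat b^T&0\end{bmatrix}.$$ $\mathbf{e}$ is the vector of ones, $I$ the identity matrix, and $F(\mathbf y)$, $\tilde F(\mathbf y)$ are the vectors obtained by applying $F,\tilde F$ to each entry $y^{(j)}\in\mathbb{R}^m$ of $\mathbf y$; the scalar matrices $S,\hat S$ act on such vectors of stages by linear combination of the entries. *)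

(* Defs.v *)
From HB Require Import structures.
From mathcomp Require Import all_boot all_order all_algebra.
From mathcomp Require Import all_classical all_reals.
From mathcomp Require Import convex.
Set Implicit Arguments.
Unset Strict Implicit.
Unset Printing Implicit Defensive.
Import Order.TTheory GRing.Theory Num.Theory.
Local Open Scope ring_scope.

Definition strictly_lower (R : realType) (s : nat) (A : 'M[R]_s) : Prop :=
  forall i j : 'I_s, (i <= j)%N -> A i j = 0.

Definition butcher_mx (R : realType) (s : nat) (A : 'M[R]_s) (b : 'cV[R]_s) :
    'M[R]_(s + 1) :=
  block_mx A 0 b^T 0.

(* A vector of n stages in R^m is an n x m matrix, one stage per row, so that
   the action of scalar matrices on stages is the matrix product on the left. *)
Definition stagewise (R : realType) (m n : nat) (F : 'rV[R]_m -> 'rV[R]_m)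
    (y : 'M[R]_(n, m)) : 'M[R]_(n, m) :=
  \matrix_(i < n) F (row i y).

Definition ones (R : realType) (n : nat) : 'cV[R]_n := const_mx 1.

(* u' results from u by one step of size dt with stages Y. *)
Definition two_derivative_step (R : realType) (m s : nat)
    (A Ahat : 'M[R]_s) (b bhat : 'cV[R]_s) (F Ft : 'rV[R]_m -> 'rV[R]_m)
    (dt : R) (u : 'rV[R]_m) (Y : 'M[R]_(s, m)) (u' : 'rV[R]_m) : Prop :=
  let y := col_mx Y u' in
  y = ones R (s + 1) *m u
      + dt *: (butcher_mx A b *m stagewise F y)
      + dt ^+ 2 *: (butcher_mx Ahat bhat *m stagewise Ft y).

Lemma butcher_mx_stagewise (R : realType) (m s : nat) (A : 'M[R]_s)
    (b : 'cV[R]_s) (F : 'rV[R]_m -> 'rV[R]_m) (Y : 'M[R]_(s, m))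
    (u' : 'rV[R]_m) :
  butcher_mx A b *m stagewise F (col_mx Y u')
  = col_mx (A *m stagewise F Y) (b^T *m stagewise F Y).
Proof.
have -> : stagewise F (col_mx Y u') = col_mx (stagewise F Y) (F u').
  apply/row_matrixP => i; rewrite rowK -(fintype.splitK i); case: (fintype.split i) => j /=.
    by rewrite !rowKu rowK.
  by rewrite !rowKd !(ord1 j) !row_id.
by rewrite /butcher_mx mul_block_col !mul0mx !addr0.
Qed.

Lemma two_derivative_stepE (R : realType) (m s : nat)
    (A Ahat : 'M[R]_s) (b bhat : 'cV[R]_s) (F Ft : 'rV[R]_m -> 'rV[R]_m)
    (dt : R) (u : 'rV[R]_m) (Y : 'M[R]_(s, m)) (u' : 'rV[R]_m)
    (hA : strictly_lower A) (hAhat : strictly_lower Ahat) :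
  two_derivative_step A Ahat b bhat F Ft dt u Y u' <->
  (forall i : 'I_s, row i Y = u
     + dt *: (\sum_(j < s | (j < i)%N) A i j *: F (row j Y))
     + dt ^+ 2 *: (\sum_(j < s | (j < i)%N) Ahat i j *: Ft (row j Y))) /\
  u' = u + dt *: (\sum_(j < s) b j ord0 *: F (row j Y))
         + dt ^+ 2 *: (\sum_(j < s) bhat j ord0 *: Ft (row j Y)).
Proof.
have rowE (B : 'M[R]_s) (G : 'rV[R]_m -> 'rV[R]_m) i : strictly_lower B ->
    row i (B *m stagewise G Y)
    = \sum_(j < s | (j < i)%N) B i j *: G (row j Y).
  move=> hB; rewrite row_mul mulmx_sum_row big_mkcond [RHS]big_mkcond /=.
  apply: eq_bigr => j _; rewrite rowK mxE; case: ltnP => // ij.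
  by rewrite hB // scale0r.
have lastE (c : 'cV[R]_s) (G : 'rV[R]_m -> 'rV[R]_m) :
    c^T *m stagewise G Y = \sum_(j < s) c j ord0 *: G (row j Y).
  by rewrite mulmx_sum_row; apply: eq_bigr => j _; rewrite rowK mxE.
have onesE : ones R (s + 1) *m u = col_mx (ones R s *m u) u.
  apply/row_matrixP => i; rewrite row_mul row_const.
  rewrite -(fintype.splitK i); case: (fintype.split i) => j /=.
    by rewrite rowKu row_mul row_const.
  rewrite rowKd (ord1 j) row_id.
  by apply/rowP => k; rewrite mxE big_ord1 !mxE mul1r.
have urow i : row i (ones R s *m u) = u.
  rewrite row_mul row_const.
  by apply/rowP => k; rewrite mxE big_ord1 !mxE mul1r.
rewrite /two_derivative_step /= !butcher_mx_stagewise onesE !scale_col_mx.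
rewrite !add_col_mx !lastE; split.
  move/eq_col_mx => [hY hu]; split => // i.
  by rewrite [in LHS]hY !linearD /= !linearZ /= !rowE // urow.
move=> [hY hu]; congr col_mx => //.
by apply/row_matrixP => i; rewrite [LHS]hY !linearD /= !linearZ /= !rowE // urow.
Qed.

Lemma butcher_mx_unit (R : realType) (s : nat) (A Ahat : 'M[R]_s)
    (b bhat : 'cV[R]_s) (p q : R)
    (hA : strictly_lower A) (hAhat : strictly_lower Ahat) :
  1%:M + p *: butcher_mx A b + q *: butcher_mx Ahat bhat \in unitmx.
Proof.
rewrite unitmxE /butcher_mx (scalar_mx_block s 1) !scale_block_mx !scaler0.
rewrite !add_block_mx !addr0 det_lblock det1 mulr1 det_trig.
  rewrite big1 ?unitr1 // => i _.
  by rewrite !mxE hA // hAhat // !mulr0 !addr0 eqxx.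
apply/is_trig_mxP => i j ij.
rewrite !mxE hA ?(ltnW ij) // hAhat ?(ltnW ij) // !mulr0 !addr0.
by rewrite -val_eqE /= ltn_eqF.
Qed.

(* Main.v *)
Require Import Defs.
From HB Require Import structures.
From mathcomp Require Import all_boot all_order all_algebra.
From mathcomp Require Import all_classical all_reals.
From mathcomp Require Import convex interval_inference ring.
Set Implicit Arguments.
Unset Strict Implicit.
Unset Printing Implicit Defensive.
Import Order.TTheory GRing.Theory Num.Theory.
Local Open Scope ring_scope.

(** The hypotheses turn the method into a Shu-Osher form. With
    [M = (I + r S + q Shat)^-1], [q = 2 r^2 / K^2 * (1 - K)] and [h = dt / r],
    adding [r S y + q Shat y] to both sides of the stage equation and
    multiplying by [M] gives ([stage_decomposition])
<<
    y = (M e) u + P (y + h F(y)) + Q (y + K h F(y) + (K h)^2 / 2 Ft(y))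
>>
    where [P] and [Q] are the matrices of the second and third hypotheses.
    All three weights are nonnegative, and they add up to one in every row:
    this is the same identity for [F = Ft = 0], whose stages are constant.

    Since [0 <= h <= dtFE], the forward Euler and Taylor conditions bound the
    functional at the two perturbed states of stage [j] by its value at
    [y^(j)]. The matrices [P] and [Q] are strictly lower triangular
    ([invmx_mul_strictly_lower]), so stage [i] is a convex combination of [u]
    and of perturbations of stages [j < i]. By strong induction on [i], all
    these points lie in the sublevel set of [u], which is convex, so stage [i]
    lies there too. The last stage is the new state. *)

(** The cone over the sublevel set at height [c], with the total weight [w] as
    an extra coordinate. It is closed under addition, so a convex combination
    can be built term by term, without renormalizing the weights at each
    step. *)
Definition sublevel_cone (R : realType) (E : lmodType R) (f : E -> R) (c w : R)
    (v : E) : Prop :=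
  0 <= w /\ exists2 x, f x <= c & v = w *: x.

Lemma convex_function_le (R : realType) (E : lmodType R) (f : E -> R) (c t : R)
    (x y : E) :
  convex_function [set: E] f -> 0 <= t -> t <= 1 -> f x <= c -> f y <= c ->
  f (t *: x + (1 - t) *: y) <= c.
Proof.
move=> cf t0 t1 xc yc.
have := cf (Itv01 t0 t1) x y; rewrite !in_setT => /(_ isT isT) /le_trans; apply.
have -> : c = t * c + (1 - t) * c by ring.
by apply: lerD; rewrite ler_wpM2l ?subr_ge0.
Qed.

Lemma sublevel_coneD (R : realType) (E : lmodType R) (f : E -> R)
    (c w1 w2 : R) (v1 v2 : E) :
  convex_function [set: E] f ->
  sublevel_cone f c w1 v1 -> sublevel_cone f c w2 v2 ->
  sublevel_cone f c (w1 + w2) (v1 + v2).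
Proof.
move=> cf [w1ge [x1 x1c ->]] [w2ge [x2 x2c ->]]; split; first exact: addr_ge0.
have [w0|wN0] := eqVneq (w1 + w2) 0.
  exists x1 => //; move/eqP: w0; rewrite paddr_eq0 // => /andP[/eqP-> /eqP->].
  by rewrite addr0 !scale0r addr0.
exists ((w1 / (w1 + w2)) *: x1 + (1 - w1 / (w1 + w2)) *: x2).
  apply: convex_function_le => //; first by rewrite divr_ge0 ?addr_ge0.
  by rewrite ler_pdivrMr ?mul1r ?lerDl // lt_def wN0 addr_ge0.
by rewrite scalerDr !scalerA; congr (_ *: _ + _ *: _); field.
Qed.

(** The point [x0] keeps the sublevel set inhabited, which is what an empty sum
    and the terms of weight zero require. *)
Lemma sublevel_cone_mulmx (R : realType) (m n p : nat) (f : 'rV[R]_m -> R)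
    (c : R) (x0 : 'rV[R]_m) (W : 'M[R]_(n, p)) (Z : 'M[R]_(p, m)) (i : 'I_n) :
  convex_function [set: 'rV[R]_m] f -> f x0 <= c ->
  (forall j, 0 <= W i j) -> (forall j, W i j != 0 -> f (row j Z) <= c) ->
  sublevel_cone f c ((W *m ones R p) i 0) (row i (W *m Z)).
Proof.
move=> cf x0c W0 fZ; rewrite mxE row_mul mulmx_sum_row.
apply: (big_ind2 (sublevel_cone f c)) => [|w1 v1 w2 v2|j _].
- by split=> //; exists x0; rewrite ?scale0r.
- exact: sublevel_coneD.
- rewrite !mxE mulr1; split=> //.
  have [->|Wij] := eqVneq (W i j) 0; first by exists x0; rewrite ?scale0r.
  by exists (row j Z); rewrite ?fZ.
Qed.

Lemma strictly_lowerD (R : realType) (n : nat) (A B : 'M[R]_n) :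
  strictly_lower A -> strictly_lower B -> strictly_lower (A + B).
Proof. by move=> hA hB i j ij; rewrite mxE hA // hB // addr0. Qed.

Lemma strictly_lowerZ (R : realType) (n : nat) (a : R) (A : 'M[R]_n) :
  strictly_lower A -> strictly_lower (a *: A).
Proof. by move=> hA i j ij; rewrite mxE hA // mulr0. Qed.

Lemma butcher_mx_strictly_lower (R : realType) (s : nat) (A : 'M[R]_s)
    (b : 'cV[R]_s) :
  strictly_lower A -> strictly_lower (butcher_mx A b).
Proof.
move=> hA i j; rewrite /butcher_mx.
rewrite -(fintype.splitK i) -(fintype.splitK j).
case: (fintype.split i) => i'; case: (fintype.split j) => j' /= ij.
- by rewrite block_mxEul hA.
- by rewrite block_mxEur mxE.
- by move: ij; rewrite leqNgt (leq_trans (ltn_ord j')) ?leq_addr.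
- by rewrite block_mxEdr mxE.
Qed.

(** Forward substitution: [X = (1 + L)^-1 T] solves [X = T - L X], and row [i]
    of [L X] involves only the rows of [X] above [i]. *)
Lemma invmx_mul_strictly_lower (R : realType) (n : nat) (L T : 'M[R]_n) :
  1%:M + L \in unitmx -> strictly_lower L -> strictly_lower T ->
  strictly_lower (invmx (1%:M + L) *m T).
Proof.
move=> uL hL hT; set X := _ *m T.
have XE : X = T - L *m X.
  have /esym : (1%:M + L) *m X = T by rewrite mulKVmx.
  by rewrite mulmxDl mul1mx => ->; rewrite addrK.
move=> i; have [k] := ubnP (i : nat); elim: k i => // k IH i ik j ij.
rewrite XE !mxE hT // big1 ?subrr // => l _.
have [il|li] := leqP i l; first by rewrite hL ?mul0r.
by rewrite IH ?mulr0 // ?(leq_trans li) // (leq_trans (ltnW li)).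
Qed.

(** The constants come from matching coefficients after multiplication by [B].
    Producing [dt^2 Shat H] from a Taylor step of length [K h] forces the weight
    [2 r^2 / K^2] on [Shat]; this brings [(2 r / K) dt Shat G] along, which the
    correction of [S] in the forward Euler weight cancels; the multiples of
    [Shat y] that remain are the last term of [B].

    [G] and [H] stand for the stage derivatives. They are arbitrary, so that
    taking them to be zero gives the sum of the weights. *)
Lemma stage_decomposition (R : realType) (m n : nat) (S Shat : 'M[R]_n)
    (r K dt : R) (u : 'rV[R]_m) (y G H : 'M[R]_(n, m)) :
  let B := 1%:M + r *: S + (2 * r ^+ 2 / K ^+ 2 * (1 - K)) *: Shat in
  r != 0 -> K != 0 -> B \in unitmx ->
  y = ones R n *m u + dt *: (S *m G) + dt ^+ 2 *: (Shat *m H) ->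
  y = (invmx B *m ones R n) *m u
      + (r *: (invmx B *m (S - (2 * r / K) *: Shat))) *m (y + (dt / r) *: G)
      + ((2 * r ^+ 2 / K ^+ 2) *: (invmx B *m Shat))
        *m (y + (K * (dt / r)) *: G + (2^-1 * (K * (dt / r)) ^+ 2) *: H).
Proof.
move=> B r0 K0 uB yE; rewrite -!scalemxAl -!mulmxA !scalemxAr -!mulmxDr.
rewrite -[LHS](mulKmx uB); congr (_ *m _).
rewrite {1}/B !mulmxDl mul1mx {1}yE mulNmx -!scalemxAl -!scalemxAr.
rewrite !mulmxDr -!scalemxAr.
move: (_ *m u) (S *m y) (S *m G) (Shat *m y) (Shat *m G) (Shat *m H).
move=> e a b c d h.
by apply/matrixP => i j; rewrite !mxE; field; rewrite r0 K0.
Qed.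

Theorem theorem1 (R : realType) (m s : nat) (hs : (0 < s)%N)
  (nrm : 'rV[R]_m -> R) (hnrm : convex_function [set: 'rV[R]_m] nrm)
  (dtFE K : R) (hdtFE : 0 < dtFE) (hK : 0 < K)
  (F Ft : 'rV[R]_m -> 'rV[R]_m)
  (forward_euler : forall (u : 'rV[R]_m) (dt : R), 0 <= dt -> dt <= dtFE ->
     nrm (u + dt *: F u) <= nrm u)
  (taylor_series : forall (u : 'rV[R]_m) (dt : R), 0 <= dt -> dt <= K * dtFE ->
     nrm (u + dt *: F u + (2^-1 * dt ^+ 2) *: Ft u) <= nrm u)
  (A Ahat : 'M[R]_s) (b bhat : 'cV[R]_s)
  (hA : strictly_lower A) (hAhat : strictly_lower Ahat)
  (r : R) (hr : 0 < r) :
  let S := butcher_mx A b in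
  let Shat := butcher_mx Ahat bhat in
  let M := invmx (1%:M + r *: S + (2 * r ^+ 2 / K ^+ 2 * (1 - K)) *: Shat) in
  (forall i j, 0 <= (M *m ones R (s + 1)) i j) ->
  (forall i j, 0 <= (r *: (M *m (S - (2 * r / K) *: Shat))) i j) ->
  (forall i j, 0 <= ((2 * r ^+ 2 / K ^+ 2) *: (M *m Shat)) i j) ->
  forall (dt : R) (u : 'rV[R]_m) (Y : 'M[R]_(s, m)) (u' : 'rV[R]_m),
    0 <= dt -> dt <= r * dtFE ->
    two_derivative_step A Ahat b bhat F Ft dt u Y u' ->
    nrm u' <= nrm u.
Proof.
move=> S Shat M M_ge0 P_ge0 Q_ge0 dt u Y u' dt0 dtr; set y := col_mx Y u'.
rewrite /two_derivative_step -/y -/S -/Shat => yE.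
pose q := 2 * r ^+ 2 / K ^+ 2 * (1 - K).
pose P := r *: (M *m (S - (2 * r / K) *: Shat)).
pose Q := (2 * r ^+ 2 / K ^+ 2) *: (M *m Shat).
pose h := dt / r.
have r0 : r != 0 by rewrite gt_eqF.
have K0 : K != 0 by rewrite gt_eqF.
have uB : 1%:M + r *: S + q *: Shat \in unitmx by exact: butcher_mx_unit.
have hS : strictly_lower S by exact: butcher_mx_strictly_lower.
have hShat : strictly_lower Shat by exact: butcher_mx_strictly_lower.
have M_mul_lower T : strictly_lower T -> strictly_lower (M *m T).
  move=> hT; rewrite /M -addrA; apply: invmx_mul_strictly_lower => //.
    by rewrite addrA.
  by apply: strictly_lowerD; apply: strictly_lowerZ.
have hP : strictly_lower P.
  apply/strictly_lowerZ/M_mul_lower; rewrite -scaleNr.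
  by apply: strictly_lowerD => //; apply: strictly_lowerZ.
have hQ : strictly_lower Q by apply/strictly_lowerZ/M_mul_lower.
have h_ge0 : 0 <= h by rewrite divr_ge0 // ltW.
have h_le : h <= dtFE by rewrite ler_pdivrMr // mulrC.
have weights i : (M *m ones R (s + 1)) i 0 + (P *m ones R (s + 1)) i 0
    + (Q *m ones R (s + 1)) i 0 = 1.
  (* The constant solution y = e of the method with F = Ft = 0 and u = 1. *)
  have := @stage_decomposition _ 1 _ S Shat r K 0 1%:M (ones R _) 0 0 r0 K0 uB.
  rewrite !mulmx0 !scaler0 !mulmx1 !addr0 => /(_ erefl) /matrixP /(_ i 0).
  by rewrite [LHS]mxE [RHS]mxE [X in X + _]mxE => /esym.
have stage_le i : nrm (row i y) <= nrm u.
  have [k] := ubnP (i : nat); elim: k i => // k IH i ik.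
  have prev (W : 'M[R]_(s + 1)) j : strictly_lower W -> W i j != 0 -> nrm (row j y) <= nrm u.
    move=> hW Wij; apply: IH; have [ij|ji] := leqP i j.
      by rewrite hW ?eqxx in Wij.
    exact: leq_trans ji _.
  rewrite (stage_decomposition r0 K0 uB yE) -/M -/P -/Q -/h.
  have rowM : row i ((M *m ones R (s + 1)) *m u)
      = (M *m ones R (s + 1)) i 0 *: u.
    by rewrite row_mul mulmx_sum_row big_ord1 row_id mxE.
  rewrite !linearD /= rowM.
  suff [_ [x xu]] : sublevel_cone nrm (nrm u) 1
      ((M *m ones R (s + 1)) i 0 *: u + row i (P *m (y + h *: stagewise F y))
       + row i (Q *m (y + (K * h) *: stagewise F y
                        + (2^-1 * (K * h) ^+ 2) *: stagewise Ft y))).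
    by rewrite -!linearD /= scale1r => ->.
  rewrite -{1}(weights i).
  apply: sublevel_coneD => //; first apply: sublevel_coneD => //.
  - by split=> //; exists u.
  - apply: (sublevel_cone_mulmx hnrm (lexx (nrm u))) => // j Pij.
    rewrite linearD linearZ /= rowK.
    exact: le_trans (forward_euler _ _ h_ge0 h_le) (prev P j hP Pij).
  - apply: (sublevel_cone_mulmx hnrm (lexx (nrm u))) => // j Qij.
    rewrite !linearD !linearZ /= !rowK.
    apply: le_trans (taylor_series _ _ _ _) (prev Q j hQ Qij).
      by rewrite mulr_ge0 // ltW.
    by rewrite ler_pM2l.
by have := stage_le (rshift s 0); rewrite /y rowKd row_id.
Qed.
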